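(* Let $p\in(2/3,1)$ and consider the ''have your cookie and eat it'' (HYC) random walk $(X_n)_{n\ge 0}$ with parameter $p$. Then $$P_1(T_0=\infty)=\frac{3p-2}{2p-1}.$$
   Context: The HYC random walk with parameter $p\in(1/2,1)$ is the following nearest-neighbour self-interacting walk $(X_n)_{n\ge0}$ on $\mathbb Z$. Initially there is one cookie at every site of $\mathbb Z$. Whenever the walk is at a site that still has its cookie, it steps right with probability $p$ and left with probability $1-p$ (given the past); if it steps left from that site, the cookie there is removed (eaten), and if it steps right the cookie remains. Whenever the walk is at a site whose cookie has been eaten, it steps left or right with probability $1/2$ each. Equivalently, from each site the walk steps right with probability $p$ until the first time it has stepped left from that site, and thereafter steps left or right from that site with equal probability. $P_x$ denotes the law of the walk started at $X_0=x$ (with a cookie initially at every site), and $T_x=\inf\{n\ge 0: X_n=x\}$. *)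

(* Defs.v *)
From HB Require Import structures.
From mathcomp Require Import all_boot all_order all_algebra.
From mathcomp Require Import all_classical all_reals all_analysis.
Set Implicit Arguments.
Unset Strict Implicit.
Unset Printing Implicit Defensive.
Import Order.TTheory GRing.Theory Num.Theory.
Local Open Scope classical_set_scope.
Local Open Scope ring_scope.

(* The library puts the discrete sigma-algebra on nat but none on int. *)
HB.instance Definition _ := isPointed.Build int 0.
HB.instance Definition _ := @isMeasurable.Build default_measure_display
  int (@discrete_measurable int) (@discrete_measurable0 int)
  (@discrete_measurableC int) (@discrete_measurableU int).

(* [cookie s n y]: after n steps along the trajectory s, site y has a cookie;
   only s 0, ..., s n are inspected. *)
Fixpoint cookie (s : nat -> int) (n : nat) (y : int) : bool :=
  if n is m.+1 then
    cookie s m y && ~~ ((s m == y) && (s m.+1 == y - 1))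
  else true.

Definition hyc_right (R : realType) (p : R) (s : nat -> int) (n : nat) : R :=
  if cookie s n (s n) then p else 2^-1.

Definition hyc_left (R : realType) (p : R) (s : nat -> int) (n : nat) : R :=
  if cookie s n (s n) then 1 - p else 2^-1.

Definition follows (T : Type) (X : nat -> T -> int) (s : nat -> int) (n : nat)
    : set T :=
  [set w | forall k, (k <= n)%N -> X k w = s k].

(* X has law P_x under P. The conditional probabilities given
   X_0 = s 0, ..., X_n = s n are multiplied out, so that they constrain nothing
   when the conditioning event is null. The two one-step probabilities add up
   to 1, which makes the walk nearest-neighbour almost surely. *)
Record is_HYC (d : measure_display) (T : measurableType d) (R : realType)
    (P : probability T R) (p : R) (x : int) (X : nat -> {RV P >-> int})
    : Prop := IsHYC {
  hyc_start : P [set w | X 0%N w = x] = 1%E;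
  hyc_stepR : forall (s : nat -> int) (n : nat),
    P (follows X s n `&` [set w | X n.+1 w = s n + 1])
      = ((hyc_right p s n)%:E * P (follows X s n))%E;
  hyc_stepL : forall (s : nat -> int) (n : nat),
    P (follows X s n `&` [set w | X n.+1 w = s n - 1])
      = ((hyc_left p s n)%:E * P (follows X s n))%E
}.

(* The infimum of the empty set is +oo. *)
Definition hitting_time (R : realType) (T : Type) (X : nat -> T -> int)
    (y : int) (w : T) : \bar R :=
  ereal_inf [set (n%:R : R)%:E | n in [set n : nat | X n w = y]].

(* Main.v *)
Require Import Defs.
From HB Require Import structures.
From mathcomp Require Import all_boot all_order all_algebra.
From mathcomp Require Import all_classical all_reals all_analysis.
From mathcomp Require Import zify ring lra.
Set Implicit Arguments.
Unset Strict Implicit.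
Unset Printing Implicit Defensive.
Import Order.TTheory GRing.Theory Num.Theory.
Import numFieldNormedType.Exports.
Local Open Scope classical_set_scope.
Local Open Scope ring_scope.

(** The position together with the set of sites that still hold their cookie is
    a Markov chain, and the theorem is a statement about its harmonic functions.

    Let [q n] be the probability that the walk from [1] reaches [n] before [0].
    With [c = (2 p - 1) / (1 - p)], position minus [c] times the number of eaten
    cookies is a martingale ([drift_martingale]): at a site with a cookie the
    drift is [2 p - 1] and the cookie is lost with probability [1 - p], and at
    the other sites nothing changes in the mean. Stopping at the exit from
    [(0, n)] gives
      [n q n = 1 + c * sum_(1 <= y < n) P(the cookie of y is eaten)].
    The cookie of [y] is eaten before the exit exactly when the walk reaches [y],
    and afterwards goes back to [y - 1] before [n]. At the first visit to [y] all
    sites from [y] onwards still have their cookies, so the second stage is a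
    fresh crossing problem on an interval of length [n - y + 1]; hence
    ([cross1_renewal])
      [n q n = 1 + c * sum_(1 <= y < n) q y * (1 - q (n - y + 1))].

    The [q n] decrease to the survival probability [theta] ([cross1_cvg]). As
    [q y >= q n], the recursion yields [n >= c * sum_(2 <= k <= n) (1 - q k)], so
    [1 >= c (1 - theta)] by averaging, and this makes [theta] positive since
    [c > 1] when [p > 2 / 3]. As [1 - q k <= 1 - theta], it also yields
    [theta <= c (1 - theta) theta], so [1 <= c (1 - theta)]. Therefore
    [theta = 1 - 1 / c] ([renewal_limit]).

    Optional stopping is replaced throughout by a maximum principle for bounded
    subharmonic functions on a finite interval ([max_principle]): two bounded
    harmonic functions with the same boundary values coincide. The passage from
    a process of the given law to the chain is [follows_hits0]. *)

(** * The chain of positions and cookies *)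

Definition eat (eta : int -> bool) (x : int) : int -> bool :=
  fun y => eta y && (y != x).

Definition right_prob (R : realType) (p : R) (eta : int -> bool)
    (x : int) : R :=
  if eta x then p else 2^-1.

(** The expectation of [F] after one step from position [x] with cookies
    [eta]; harmonic means being equal to this average. *)
Definition mean_step (R : realType) (p : R) (F : int -> (int -> bool) -> R)
    (x : int) (eta : int -> bool) : R :=
  right_prob p eta x * F (x + 1) eta
  + (1 - right_prob p eta x) * F (x - 1) (eat eta x).

(** The probability of being in [B] within [t] steps, along a path whose earlier
    positions all lie in [D]. *)
Fixpoint reach (R : realType) (p : R) (B D : pred int) (t : nat)
    (x : int) (eta : int -> bool) : R :=
  if B x then 1 else
  if t is t'.+1 then
    if D x then mean_step p (reach p B D t') x eta else 0
  else 0.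

Definition reach_ever (R : realType) (p : R) (B D : pred int)
    (x : int) (eta : int -> bool) : R :=
  limn (fun t => reach p B D t x eta).

Section HYCChain.
Variables (R : realType) (p : R).
Hypotheses (p_gt_half : 2^-1 < p) (p_lt1 : p < 1).
Implicit Types (F G : int -> (int -> bool) -> R) (eta : int -> bool).
Implicit Types (B D : pred int).

Lemma right_prob_ge_half eta x : 2^-1 <= right_prob p eta x.
Proof. by rewrite /right_prob; case: ifP => // _; exact: ltW. Qed.

Lemma right_prob_le1 eta x : right_prob p eta x <= 1.
Proof. by rewrite /right_prob; case: ifP => _; [exact: ltW|lra]. Qed.

Lemma le_mean_step F G x eta : F (x + 1) eta <= G (x + 1) eta ->
  F (x - 1) (eat eta x) <= G (x - 1) (eat eta x) ->
  mean_step p F x eta <= mean_step p G x eta.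
Proof.
have h1 := right_prob_ge_half eta x; have h2 := right_prob_le1 eta x.
by move=> FG1 FG2; apply: lerD; apply: ler_wpM2l => //; lra.
Qed.

Lemma mean_step_cst (a : R) x eta : mean_step p (fun _ _ => a) x eta = a.
Proof. by rewrite /mean_step; ring. Qed.

Lemma reach_ge0 B D t x eta : 0 <= reach p B D t x eta.
Proof.
elim: t x eta => [|t IHt] x eta /=; first by case: ifP.
case: ifP => // _; case: ifP => // _.
by rewrite -[leLHS](mean_step_cst 0 x eta) le_mean_step.
Qed.

Lemma reach_le1 B D t x eta : reach p B D t x eta <= 1.
Proof.
elim: t x eta => [|t IHt] x eta /=; first by case: ifP.
case: ifP => // _; case: ifP => // _.
by rewrite -[leRHS](mean_step_cst 1 x eta) le_mean_step.
Qed.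

Lemma reach_leS B D t x eta : reach p B D t x eta <= reach p B D t.+1 x eta.
Proof.
elim: t x eta => [|t IHt] x eta.
  by have := reach_ge0 B D 1 x eta; rewrite /=; case: ifP.
rewrite /= -/(reach p B D t) -/(reach p B D t.+1).
case: ifP => // _; case: ifP => // _.
by apply: le_mean_step; exact: IHt.
Qed.

Lemma reach_nd B D x eta : nondecreasing_seq (fun t => reach p B D t x eta).
Proof. by apply/nondecreasing_seqP => t; exact: reach_leS. Qed.

Lemma reach_cvg B D x eta :
  reach p B D t x eta @[t --> \oo] --> reach_ever p B D x eta.
Proof.
apply: nondecreasing_is_cvgn; first exact: reach_nd.
by exists 1 => _ [t _ <-]; exact: reach_le1.
Qed.

Lemma reach_le_ever B D t x eta : reach p B D t x eta <= reach_ever p B D x eta.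
Proof.
apply: (nondecreasing_cvgn_le (@reach_nd B D x eta)).
by apply/cvg_ex; eexists; exact: reach_cvg.
Qed.

Lemma reach_ever_ge0 B D x eta : 0 <= reach_ever p B D x eta.
Proof. exact: le_trans (reach_ge0 _ _ 0 _ _) (reach_le_ever _ _ _ _ _). Qed.

Lemma reach_ever_le1 B D x eta : reach_ever p B D x eta <= 1.
Proof.
apply: limr_le; first by apply/cvg_ex; eexists; exact: reach_cvg.
by near=> t; exact: reach_le1.
Unshelve. all: end_near. Qed.

Lemma reach_ever_target B D x eta : B x -> reach_ever p B D x eta = 1.
Proof.
move=> Bx; apply/eqP; rewrite eq_le reach_ever_le1 /=.
by apply: le_trans (reach_le_ever _ _ 0 _ _); rewrite /= Bx.
Qed.

Lemma reach_ever_out B D x eta :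
  ~~ B x -> ~~ D x -> reach_ever p B D x eta = 0.
Proof.
move=> /negbTE Bx /negbTE Dx.
rewrite /reach_ever (_ : (fun t => _) = fun=> 0); first exact: lim_cst.
by apply/funext => -[|t] /=; rewrite Bx // Dx.
Qed.

Lemma reach_ever_harmonic B D x eta : ~~ B x -> D x ->
  reach_ever p B D x eta = mean_step p (reach_ever p B D) x eta.
Proof.
move=> /negbTE Bx Dx.
have : reach p B D t.+1 x eta @[t --> \oo] --> reach_ever p B D x eta.
  by rewrite (cvg_shiftS (fun t => reach p B D t x eta)); exact: reach_cvg.
move/cvg_lim => <- //; apply: cvg_lim => //; rewrite /= Bx Dx.
by apply: cvgD; apply: cvgMr; exact: reach_cvg.
Qed.

(** Whatever the cookies are, each step goes right with probability at least
    one half, so from any point of [[0, n]] the walk runs straight into [n] with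
    probability at least [2^-n]. An upper bound [m] for [F] hence improves to
    [m (1 - 2^-n)], and iteration brings it down to [0]. The predicate [A], stable
    under the two possible steps, restricts everything to a class of reachable
    states. *)
Lemma max_principle (A : int -> (int -> bool) -> Prop) (n : nat) F (M : R) :
  (forall x eta, A x eta -> A (x + 1) eta /\ A (x - 1) (eat eta x)) ->
  (forall x eta, A x eta -> 0 < x < n%:Z -> F x eta <= mean_step p F x eta) ->
  (forall x eta, A x eta -> x = 0 \/ x = n -> F x eta <= 0) ->
  (forall x eta, A x eta -> 0 <= x <= n%:Z -> F x eta <= M) ->
  forall x eta, A x eta -> 0 <= x <= n%:Z -> F x eta <= 0.
Proof.
move=> Astep Fsub Fbd FM.
have contract (m : R) : 0 <= m ->
    (forall x eta, A x eta -> 0 <= x <= n%:Z -> F x eta <= m) ->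
    forall x eta, A x eta -> 0 <= x <= n%:Z -> F x eta <= m * (1 - 2^-1 ^+ n).
  move=> m0 Fm.
  have pow_le1 j : (2^-1 : R) ^+ j <= 1 by apply: exprn_ile1; lra.
  have pow_ge0 j : 0 <= (2^-1 : R) ^+ j by apply: exprn_ge0; lra.
  (* [2^-j] bounds the chance to step right [j] times in a row *)
  have near_top (j : nat) x eta : A x eta -> 0 <= x <= n%:Z -> n%:Z - x <= j ->
      F x eta <= m * (1 - 2^-1 ^+ j).
    elim: j x eta => [|j IHj] x eta Ax x0n xj.
      by rewrite expr0 subrr mulr0; apply: Fbd => //; right; lia.
    have [inx|bdx] := boolP (0 < x < n%:Z); last first.
      have xb : x = 0 \/ x = n by move: bdx x0n; lia.
      apply: (le_trans (Fbd _ _ Ax xb)); apply: mulr_ge0 => //.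
      by rewrite subr_ge0.
    have [A1 A2] := Astep _ _ Ax.
    apply: le_trans (Fsub _ _ Ax inx) _.
    have r1 := right_prob_ge_half eta x; have r2 := right_prob_le1 eta x.
    have F1 : F (x + 1) eta <= m * (1 - 2^-1 ^+ j) by apply: IHj => //; lia.
    have F2 : F (x - 1) (eat eta x) <= m by apply: Fm => //; lia.
    rewrite /mean_step exprS; set r := right_prob p eta x in r1 r2 *.
    have e0 := pow_ge0 j; set e := 2^-1 ^+ j in e0 F1 *.
    have H1 : r * F (x + 1) eta <= r * (m * (1 - e)).
      by apply: ler_wpM2l => //; lra.
    have H2 : (1 - r) * F (x - 1) (eat eta x) <= (1 - r) * m.
      by apply: ler_wpM2l => //; lra.
    have H3 : 0 <= m * e * (r - 2^-1).
      by apply: mulr_ge0; [exact: mulr_ge0|lra].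
    lra.
  by move=> x eta Ax x0n; apply: near_top => //; lia.
move=> x eta Ax x0n.
pose a : R := 1 - 2^-1 ^+ n.
have a01 : 0 <= a < 1.
  have : 0 < (2^-1 : R) ^+ n by apply: exprn_gt0; lra.
  have : (2^-1 : R) ^+ n <= 1 by apply: exprn_ile1; lra.
  by rewrite /a; lra.
pose m := Num.max M 0.
have Fk k : forall x eta, A x eta -> 0 <= x <= n%:Z -> F x eta <= m * a ^+ k.
  elim: k => [|k IHk] y zeta Ay y0n.
    rewrite expr0 mulr1; apply: (le_trans (FM _ _ Ay y0n)).
    by rewrite le_max lexx.
  rewrite exprSr mulrA; apply: contract => //.
  by apply: mulr_ge0; [rewrite le_max lexx orbT|apply: exprn_ge0; lra].
have : m * a ^+ k @[k --> \oo] --> m * 0.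
  by apply: cvgMr; apply: cvg_expr; rewrite ger0_norm; lra.
rewrite mulr0 => ma0.
rewrite -(cvg_lim _ ma0) //.
apply: limr_ge; first by apply/cvg_ex; eexists; exact: ma0.
by near=> k; exact: Fk.
Unshelve. all: end_near. Qed.

Lemma max_principle_eq0 (A : int -> (int -> bool) -> Prop) (n : nat) F (M : R) :
  (forall x eta, A x eta -> A (x + 1) eta /\ A (x - 1) (eat eta x)) ->
  (forall x eta, A x eta -> 0 < x < n%:Z -> F x eta = mean_step p F x eta) ->
  (forall x eta, A x eta -> x = 0 \/ x = n -> F x eta = 0) ->
  (forall x eta, A x eta -> 0 <= x <= n%:Z -> `|F x eta| <= M) ->
  forall x eta, A x eta -> 0 <= x <= n%:Z -> F x eta = 0.
Proof.
move=> Astep Fharm Fbd FM x eta Ax x0n.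
apply/eqP; rewrite eq_le; apply/andP; split.
  apply: (max_principle (M := M) Astep) Ax x0n => y zeta Ay yn.
  - by rewrite -Fharm.
  - by rewrite Fbd.
  - exact: le_trans (ler_norm _) (FM _ _ Ay yn).
rewrite -oppr_le0; pose G y zeta := - F y zeta.
apply: (max_principle (F := G) (M := M) Astep) Ax x0n => y zeta Ay yn; rewrite /G.
- rewrite (Fharm _ _ Ay yn) [leRHS](_ : _ = - mean_step p F y zeta) //.
  by rewrite /mean_step; ring.
- by rewrite Fbd // oppr0.
- by apply: le_trans (FM _ _ Ay yn); rewrite -normrN ler_norm.
Qed.

End HYCChain.

(** * Crossing an interval *)

(** The probability of hitting [n] before the walk leaves the positive sites. *)
Definition cross (R : realType) (p : R) (n : nat) : int -> (int -> bool) -> R :=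
  reach_ever p (fun z => z == n :> int) (fun z => 0 < z).

Definition cross1 (R : realType) (p : R) (n : nat) : R :=
  cross p n 1 (fun=> true).

Definition origin : pred int := fun z => z == 0.

(** An uneaten cookie to the right of the walk shows that its site has not been
    left to the left, hence has never been visited: neither have the sites
    further right. *)
Definition fresh_beyond (x : int) (eta : int -> bool) : Prop :=
  forall y z : int, x < y -> eta y -> y <= z -> eta z.

(** On states with [fresh_beyond], the probability that the cookie of [y] is eaten
    by the time the walk exits [(0, n)]. To the left of [y] the walk has to reach
    [y] first, and then faces a fresh environment; from [y] onwards, the cookie
    goes when the walk steps to [y - 1] before hitting [n], which is the failure
    of a crossing of the interval [(y - 1, n)], translated to [(0, n - y + 1)]. *)
Definition eaten_before_exit (R : realType) (p : R) (n y : nat)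
    (x : int) (eta : int -> bool) : R :=
  if ~~ eta y then 1
  else if x < y%:Z then cross p y x eta * (1 - cross1 p (n - y).+1)
  else 1 - cross p (n - y).+1 (x - (y%:Z - 1)) (fun z => eta (z + (y%:Z - 1))).

Section Crossing.
Variables (R : realType) (p : R).
Hypotheses (p_gt_half : 2^-1 < p) (p_lt1 : p < 1).
Implicit Types (n y t : nat) (x : int) (eta : int -> bool).

Let c : R := (2 * p - 1) / (1 - p).

Lemma fresh_beyond_step x eta : fresh_beyond x eta ->
  fresh_beyond (x + 1) eta /\ fresh_beyond (x - 1) (eat eta x).
Proof.
move=> fr; split=> y z.
  by move=> xy; apply: fr; lia.
by rewrite /eat => xy /andP[etay yx] yz; apply/andP; split;
  [apply: (fr y) => //; lia|lia].
Qed.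

Lemma cross_ge0 n x eta : 0 <= cross p n x eta.
Proof. exact: reach_ever_ge0. Qed.

Lemma cross_le1 n x eta : cross p n x eta <= 1.
Proof. exact: reach_ever_le1. Qed.

Lemma cross_top n eta : cross p n n eta = 1.
Proof. by apply: reach_ever_target => //=. Qed.

Lemma cross_bottom n eta : (0 < n)%N -> cross p n 0 eta = 0.
Proof. by move=> n0; apply: reach_ever_out => //=; lia. Qed.

Lemma cross_harmonic n x eta : 0 < x < n%:Z ->
  cross p n x eta = mean_step p (cross p n) x eta.
Proof. by move=> xn; apply: reach_ever_harmonic => //=; lia. Qed.

(** Before its exit the walk sees the cookies at positive sites only. *)
Lemma cross_local n x eta eta' : (forall z, 0 < z -> eta z = eta' z) ->
  cross p n x eta = cross p n x eta'.
Proof.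
move=> ee; rewrite /cross /reach_ever; congr (limn _); apply/funext => t.
elim: t x eta eta' ee => [//|t IHt] x eta eta' ee /=.
case: ifP => // _; case: ifP => // x0.
rewrite /mean_step /right_prob (ee _ x0); congr (_ + _ * _); [congr (_ * _)|];
  apply: IHt => // z z0.
by rewrite /eat ee.
Qed.

Lemma cross_fresh n eta : (forall z, 0 < z -> eta z) ->
  cross p n 1 eta = cross1 p n.
Proof. by move=> fr; apply: cross_local => z /fr ->. Qed.

(** The two expressions for the probability fit together at [y]: arriving from the
    left the environment at and beyond [y] is fresh, and stepping from [y] to the
    left eats the cookie, which matches a failed crossing. *)
Lemma eaten_before_exit_harmonic n y x eta : fresh_beyond x eta ->
  (0 < y < n)%N -> 0 < x < n%:Z ->
  eaten_before_exit p n y x eta = mean_step p (eaten_before_exit p n y) x eta.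
Proof.
move=> fr yn xn; rewrite {1}/eaten_before_exit.
have [etay|etay] := boolP (eta y); last first.
  by rewrite /mean_step /eaten_before_exit /eat (negbTE etay) /=; ring.
have [xy|yx] /= := ltP x y%:Z.
  rewrite cross_harmonic; last by lia.
  rewrite /mean_step mulrDl -!mulrA; congr (_ * _ + _ * _).
  - rewrite /eaten_before_exit etay /=; case: ltP => // xy1.
    have -> : x + 1 = y by lia.
    rewrite cross_top mul1r; congr (1 - _); apply/esym.
    have -> : y%:Z - (y%:Z - 1) = 1 by lia.
    by apply: cross_fresh => z z0; apply: (fr y) => //; lia.
  - rewrite /eaten_before_exit /eat etay /=.
    have -> : (y%:Z != x) = true by lia.
    by have -> : x - 1 < y%:Z by lia.
rewrite cross_harmonic; last by lia.
rewrite /mean_step /right_prob subrK.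
set r := if _ then _ else _.
have -> : eaten_before_exit p n y (x + 1) eta =
    1 - cross p (n - y).+1 (x - (y%:Z - 1) + 1) (fun z => eta (z + (y%:Z - 1))).
  rewrite /eaten_before_exit etay /=; have -> : (x + 1 < y%:Z) = false by lia.
  by congr (1 - cross _ _ _ _); lia.
suff -> : eaten_before_exit p n y (x - 1) (eat eta x) =
    1 - cross p (n - y).+1 (x - (y%:Z - 1) - 1)
          (eat (fun z => eta (z + (y%:Z - 1))) (x - (y%:Z - 1))).
  by ring.
rewrite /eaten_before_exit /eat etay /=.
have [xy|xy] := eqVneq y%:Z x.
  rewrite /= -xy; have -> : y%:Z - (y%:Z - 1) - 1 = 0 by lia.
  by rewrite cross_bottom // subr0.
have -> /= : (x - 1 < y%:Z) = false by lia.
have -> : x - 1 - (y%:Z - 1) = x - (y%:Z - 1) - 1 by lia.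
congr (1 - _); apply: cross_local => z _; congr (_ && _); lia.
Qed.

Lemma eaten_before_exit_boundary n y x eta : (0 < y < n)%N ->
  x = 0 \/ x = n -> eaten_before_exit p n y x eta = (~~ eta y)%:R.
Proof.
move=> yn xb; rewrite /eaten_before_exit; case: ifP => // _.
case: xb => ->.
  have -> : 0 < y%:Z by lia.
  by rewrite cross_bottom ?mul0r //; lia.
have -> : (n%:Z < y%:Z) = false by lia.
have -> : n%:Z - (y%:Z - 1) = (n - y).+1%:Z by lia.
by rewrite cross_top subrr.
Qed.

Lemma eaten_before_exit_ge0 n y x eta : 0 <= eaten_before_exit p n y x eta.
Proof.
rewrite /eaten_before_exit; case: ifP => // _; case: ifP => // _.
  by apply: mulr_ge0; rewrite ?subr_ge0 ?cross_ge0 ?cross_le1.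
by rewrite subr_ge0 cross_le1.
Qed.

Lemma eaten_before_exit_le1 n y x eta : eaten_before_exit p n y x eta <= 1.
Proof.
rewrite /eaten_before_exit; case: ifP => // _; case: ifP => // _.
  apply: mulr_ile1; rewrite ?subr_ge0 ?cross_ge0 ?cross_le1 //.
  by rewrite gerBl cross_ge0.
by rewrite gerBl cross_ge0.
Qed.

Lemma eaten_eat n x eta : 0 < x < n%:Z ->
  \sum_(1 <= y < n) ((~~ eat eta x y)%:R : R) =
  \sum_(1 <= y < n) (~~ eta y)%:R + (eta x)%:R.
Proof.
move=> xn.
have -> : (eta x)%:R =
    \sum_(1 <= y < n) (if y == `|x|%N then (eta x)%:R else 0) :> R.
  rewrite -big_mkcond big_nat1_eq.
  by have -> : (1 <= `|x| < n)%N by lia.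
rewrite -big_split /=; apply: eq_bigr => y _.
rewrite /eat; have -> : (y == `|x|%N) = (y%:Z == x) by lia.
by case: eqP => [->|_] /=; case: (eta _); rewrite ?andbF ?andbT /= ?addr0 ?add0r.
Qed.

(** [c] is chosen so that [p - (1 - p) = c (1 - p)]: the drift gained at a site
    with a cookie pays for the expected loss of that cookie. *)
Lemma drift_martingale n x eta : 0 < x < n%:Z ->
  let M x eta : R := x%:~R - c * \sum_(1 <= y < n) (~~ eta y%:Z)%:R in
  M x eta = mean_step p M x eta.
Proof.
move=> xn /=; rewrite /mean_step (eaten_eat eta xn) !intrD /right_prob.
have p1 : 1 - p != 0 by rewrite lt0r_neq0 ?subr_gt0.
set S := \sum_(_ <= _ < _) _.
by rewrite /c; case: (eta x) => /=; field.
Qed.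

(** Optional stopping for [drift_martingale] at the exit from [(0, n)]: there, it
    equals [n] times the indicator of the top minus [c] times the number of eaten
    cookies, and so it is the same combination of [cross] and
    [eaten_before_exit] at all states. *)
Lemma cross1_renewal n : (0 < n)%N ->
  n%:R * cross1 p n =
  1 + c * \sum_(1 <= y < n) cross1 p y * (1 - cross1 p (n - y).+1).
Proof.
move=> n0.
(* the martingale minus the harmonic extension of its boundary values *)
pose F x eta : R := (x%:~R - c * \sum_(1 <= y < n) (~~ eta y%:Z)%:R)
  + (c * \sum_(1 <= y < n) eaten_before_exit p n y x eta
     - n%:R * cross p n x eta).
have sum_bd (f : nat -> R) : (forall y, 0 <= f y <= 1) ->
    0 <= \sum_(1 <= y < n) f y <= n%:R.
  move=> f01; rewrite sumr_ge0 => [|y _]; last by case/andP: (f01 y).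
  apply: (@le_trans _ _ (\sum_(1 <= y < n) 1)).
    by apply: ler_sum => y _; case/andP: (f01 y).
  by rewrite sumr_const_nat ler_nat leq_subr.
have c0 : 0 <= c.
  by have := p_gt_half; have := p_lt1; move=> *; apply: divr_ge0; lra.
have F0 : F 1 (fun=> true) = 0.
  apply: (@max_principle_eq0 R p p_gt_half p_lt1 fresh_beyond n F
    (n%:R + c * n%:R + (c * n%:R + n%:R))).
  - exact: fresh_beyond_step.
  - move=> x eta fr xn; rewrite {1}/F.
    rewrite (drift_martingale _ xn) (cross_harmonic _ xn).
    rewrite (eq_big_nat _ _ (F2 := fun y =>
      mean_step p (eaten_before_exit p n y) x eta)); last first.
      by move=> y yn; exact: eaten_before_exit_harmonic.
    rewrite /mean_step big_split /= -!mulr_sumr /F; ring.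
  - move=> x eta _ xb; rewrite /F.
    rewrite [X in c * X - _](eq_big_nat _ _
      (F2 := fun y => (~~ eta y%:Z)%:R)); last first.
      by move=> y yn; exact: eaten_before_exit_boundary.
    case: xb => ->; [rewrite cross_bottom // |rewrite cross_top]; ring.
  - move=> x eta _ xn; rewrite /F.
    have := sum_bd (fun y => (~~ eta y%:Z)%:R).
    set S1 := \sum_(_ <= _ < _) _ => /(_ _)/andP[].
      by move=> y; case: (eta _); rewrite !lexx ler01.
    move=> S10 S1n.
    have := sum_bd (fun y => eaten_before_exit p n y x eta).
    set S2 := \sum_(_ <= _ < _) _ => /(_ _)/andP[].
      by move=> y; rewrite eaten_before_exit_ge0 eaten_before_exit_le1.
    move=> S20 S2n.
    have x0 : 0 <= x%:~R :> R by rewrite ler0z; lia.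
    have xn' : x%:~R <= n%:R :> R by rewrite -[n%:R]/(n%:Z%:~R) ler_int; lia.
    have h0 := cross_ge0 n x eta; have h1 := cross_le1 n x eta.
    have a1 : c * S1 <= c * n%:R by exact: ler_wpM2l.
    have a2 : c * S2 <= c * n%:R by exact: ler_wpM2l.
    have a3 : n%:R * cross p n x eta <= n%:R by rewrite ler_piMr.
    have b1 : 0 <= c * S1 by exact: mulr_ge0.
    have b2 : 0 <= c * S2 by exact: mulr_ge0.
    have b3 : 0 <= n%:R * cross p n x eta by exact: mulr_ge0.
    by rewrite ler_norml; lra.
  - by [].
  - by lia.
move: F0; rewrite /F big1 // mulr0 subr0.
rewrite (eq_big_nat _ _
  (F2 := fun y => cross1 p y * (1 - cross1 p (n - y).+1))).
  by rewrite -/(cross1 p n) => F0; rewrite mulr1z in F0; lra.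
(* the walk starts at [y] itself only when [y = 1], and then [q 1 = 1] *)
move=> y yn; rewrite /eaten_before_exit /=; case: ltP => // y1.
have -> : y = 1%N by lia.
by rewrite subrr subr0 {1}/cross1 cross_top mul1r.
Qed.

Lemma cross1_ge0 n : 0 <= cross1 p n. Proof. exact: cross_ge0. Qed.
Lemma cross1_le1 n : cross1 p n <= 1. Proof. exact: cross_le1. Qed.

(** The walk has to pass [m] before [n]. *)
Lemma le_cross1 m n : (0 < m <= n)%N -> cross1 p n <= cross1 p m.
Proof.
move=> mn; rewrite -subr_le0.
apply: (@max_principle R p p_gt_half p_lt1 (fun _ _ => True) m
  (fun x eta => cross p n x eta - cross p m x eta) 1) => //; last by lia.
- move=> x eta _ xm; rewrite !cross_harmonic ?/mean_step; [|lia..].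
  by rewrite le_eqVlt; apply/orP; left; apply/eqP; ring.
- move=> x eta _ [->|->].
    by rewrite !cross_bottom ?subrr //; lia.
  by rewrite cross_top subr_le0 cross_le1.
- move=> x eta _ _.
  by have := cross_ge0 m x eta; have := cross_le1 n x eta; lra.
Qed.

Let ruin t := reach p origin xpredT t 1 (fun=> true).
Let ruin_ever := reach_ever p origin xpredT 1 (fun=> true).

Lemma reach_origin_far t x eta : t%:Z < x -> reach p origin xpredT t x eta = 0.
Proof.
elim: t x eta => [|t IHt] x eta tx /=; rewrite /origin.
  by have -> : (x == 0) = false by lia.
have -> : (x == 0) = false by lia.
by rewrite /mean_step !IHt ?mulr0 ?addr0 //; lia.
Qed.

(** A walk that has reached [n > t] cannot be back at [0] within [t] steps. *)
Lemma cross_le_survival t n x eta : (t < n)%N -> 0 <= x <= n%:Z ->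
  cross p n x eta <= 1 - reach p origin xpredT t x eta.
Proof.
elim: t x eta => [|t IHt] x eta tn xn /=.
  case: (eqVneq x 0) => [->|x0]; first by rewrite cross_bottom ?subrr.
  rewrite /origin (negbTE x0).
  by rewrite subr0 cross_le1.
case: (eqVneq x 0) => [->|x0]; first by rewrite cross_bottom ?subrr //; lia.
rewrite {1}/origin (negbTE x0).
have [xn'|xn'] := eqVneq x n.
  rewrite /mean_step !reach_origin_far ?mulr0 ?addr0 ?subr0 ?cross_le1 //; lia.
rewrite cross_harmonic; last by lia.
set G := reach p _ _ t.
have -> : 1 - mean_step p G x eta =
    mean_step p (fun z zeta => 1 - G z zeta) x eta.
  by rewrite /mean_step; ring.
by apply: le_mean_step => //; apply: IHt; lia.
Qed.

(** A surviving walk leaves [(0, n)] almost surely, hence through [n]; here the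
    maximum principle supplies the almost sure exit. *)
Lemma survival_le_cross1 n : (0 < n)%N -> 1 - ruin_ever <= cross1 p n.
Proof.
move=> n0; rewrite -subr_le0.
pose G := reach_ever p origin xpredT.
apply: (@max_principle R p p_gt_half p_lt1 (fun _ _ => True) n
  (fun x eta => 1 - G x eta - cross p n x eta) 1) => //.
- move=> x eta _ xm; rewrite cross_harmonic // /G.
  rewrite reach_ever_harmonic //; last first.
    by rewrite /origin; lia.
  by rewrite /mean_step le_eqVlt; apply/orP; left; apply/eqP; ring.
- move=> x eta _ [->|->].
    by rewrite cross_bottom // /G reach_ever_target // subrr subr0.
  have := reach_ever_ge0 p_gt_half p_lt1 origin xpredT n eta.
  by rewrite cross_top -/(G _ _); lra.
- move=> x eta _ _.
  have := reach_ever_ge0 p_gt_half p_lt1 origin xpredT x eta.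
  by rewrite -/(G _ _); have := cross_ge0 n x eta; lra.
Qed.

Lemma cross1_cvg : cross1 p n @[n --> \oo] --> 1 - ruin_ever.
Proof.
rewrite -(cvg_shiftS (cross1 p)).
apply: (@squeeze_cvgr _ _ _ _ (fun=> 1 - ruin_ever) (fun t => 1 - ruin t)).
- apply: nearW => t; rewrite survival_le_cross1 //=.
  by apply: cross_le_survival => //; lia.
- exact: cvg_cst.
- by apply: cvgB; [exact: cvg_cst|exact: reach_cvg].
Qed.

End Crossing.

(** * The limit of the renewal recursion *)

(** Monotonicity bounds one factor of each summand of the convolution, by [u n] or
    by [1 - theta], and what remains is an average to which Cesaro applies. The
    first bound gives [c (1 - theta) <= 1], which rules out the solution
    [theta = 0] of the limit equation [theta = c (1 - theta) theta]. *)
Lemma renewal_limit (R : realType) (c theta : R) (u : nat -> R) :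
  1 < c -> (forall n, 0 <= u n <= 1) ->
  (forall m n, (0 < m <= n)%N -> u n <= u m) ->
  u n @[n --> \oo] --> theta ->
  (forall n, (0 < n)%N ->
    n%:R * u n = 1 + c * \sum_(1 <= y < n) u y * (1 - u (n - y).+1)) ->
  theta = 1 - c^-1.
Proof.
move=> c1 u01 u_ni u_theta renewal.
have c0 : 0 <= c by lra.
have theta_le n : (0 < n)%N -> theta <= u n.
  move=> n0; rewrite -(cvg_lim _ u_theta) //.
  apply: limr_le; first by apply/cvg_ex; eexists; exact: u_theta.
  by near=> m; apply: u_ni; rewrite n0 /=; near: m; exact: nbhs_infty_ge.
have theta1 : theta <= 1.
  by apply: (le_trans (theta_le 1%N _)) => //; case/andP: (u01 1%N).
have u_shift k : u (n + k)%N @[n --> \oo] --> theta by rewrite cvg_shiftn.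
have lower : c * (1 - theta) <= 1.
  (* [1 - u (n - y).+1] for [1 <= y < n] runs through the indices [2, ..., n] *)
  pose w k := 1 - u (k + 2)%N.
  have w_cvg : arithmetic_mean w n @[n --> \oo] --> 1 - theta.
    by apply: cesaro; apply: cvgB; [exact: cvg_cst|exact: u_shift].
  have cw_cvg : c * arithmetic_mean w n @[n --> \oo] --> c * (1 - theta).
    exact: cvgMr.
  have h_cvg : 1 + harmonic n @[n --> \oo] --> 1 + (0 : R).
    by apply: cvgD; [exact: cvg_cst|exact: cvg_harmonic].
  rewrite -[leRHS]addr0.
  apply: (ler_cvg_to cw_cvg h_cvg); apply: nearW => n.
  have un0 : 0 < u n.+2.
    have : 0 < n.+2%:R * u n.+2.
      rewrite renewal // ltr_pwDl // mulr_ge0 // sumr_ge0 // => y _.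
      have /andP[? ?] := u01 y; have /andP[? ?] := u01 (n.+2 - y).+1.
      by apply: mulr_ge0 => //; lra.
    by rewrite pmulr_rgt0.
  have : u n.+2 * (c * series w n.+1) <= u n.+2 * n.+2%:R.
    rewrite [leRHS]mulrC renewal // mulrCA.
    apply: ler_wpDl => //; apply: ler_wpM2l => //.
    have -> : series w n.+1 = \sum_(1 <= y < n.+2) (1 - u (n.+2 - y).+1).
      rewrite big_nat_rev /= seriesEnat /= big_add1 /=; apply: eq_big_nat => y yn.
      by rewrite /w; congr (1 - u _); lia.
    rewrite mulr_sumr ler_sum_nat // => y yn; apply: ler_wpM2r.
      by have /andP[? ?] := u01 (n.+2 - y).+1; lra.
    by apply: u_ni; lia.
  rewrite ler_pM2l // /arithmetic_mean /harmonic /= => H.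
  have N0 : 0 < n.+1%:R :> R by rewrite ltr0n.
  rewrite -(ler_pM2l N0) mulrCA mulVKf ?gt_eqF //.
  by rewrite mulrDr mulr1 mulfV ?gt_eqF // natr1.
have upper : theta <= c * (1 - theta) * theta.
  pose w k := u (k + 1)%N.
  have w_cvg : arithmetic_mean w n @[n --> \oo] --> theta.
    by apply: cesaro; exact: u_shift.
  have rhs_cvg : harmonic n + c * (1 - theta) * arithmetic_mean w n
      @[n --> \oo] --> (0 : R) + c * (1 - theta) * theta.
    by apply: cvgD; [exact: cvg_harmonic|exact: cvgMr].
  rewrite -[leRHS]add0r.
  apply: (ler_cvg_to (u_shift 2%N) rhs_cvg); apply: nearW => n.
  have N0 : 0 < n.+1%:R :> R by rewrite ltr0n.
  rewrite /arithmetic_mean /harmonic /= -(ler_pM2l N0) mulrDr mulfV ?gt_eqF //.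
  rewrite (mulrCA n.+1%:R) mulVKf ?gt_eqF //.
  apply: (@le_trans _ _ (n.+2%:R * u n.+2)).
    rewrite addn2; apply: ler_wpM2r; first by case/andP: (u01 n.+2).
    by rewrite ler_nat.
  rewrite renewal // lerD2l -mulrA ler_wpM2l //.
  rewrite seriesEnat /= mulr_sumr big_add1 /= ler_sum_nat // => y yn.
  rewrite /w addn1 mulrC; apply: ler_wpM2r; first by case/andP: (u01 y.+1).
  by rewrite lerD2l lerN2 theta_le.
have cV : c * c^-1 = 1 by rewrite mulfV //; lra.
have theta_gt0 : 0 < theta.
  have : c * (1 - theta) < c by lra.
  by rewrite gtr_pMr; lra.
have : 1 <= c * (1 - theta).
  by move: upper; rewrite ler_pMl.
move=> ?; have e : c * (1 - theta) = c * c^-1 by lra.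
have /mulfI /(_ _ _ e) : c != 0 by apply: lt0r_neq0; lra.
lra.
Unshelve. all: end_near. Qed.

(** * From the process to the chain *)

(** [A] and [B] exhaust [F] up to a null set. This is how the two one-step
    probabilities, which add up to one, make the walk nearest-neighbour. *)
Lemma probability_split (d : measure_display) (T : measurableType d)
    (R : realType) (P : probability T R) (F A B E : set T) :
  measurable F -> measurable A -> measurable B -> measurable E ->
  A `<=` F -> B `<=` F -> A `&` B = set0 -> P F = (P A + P B)%E ->
  P (F `&` E) = (P (A `&` E) + P (B `&` E))%E.
Proof.
move=> mF mA mB mE AF BF AB PF.
have mAB : measurable (A `|` B) by exact: measurableU.
have mN : measurable (F `\` (A `|` B)) by exact: measurableD.
have PAB : P (A `|` B) = (P A + P B)%E by apply: measureU.
have N0 : P (F `\` (A `|` B)) = 0%E.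
  have FAB : F `&` (A `|` B) = A `|` B by apply: setIidr; rewrite subUset.
  have -> : P (F `\` (A `|` B)) = (P F - P (A `|` B))%E.
    rewrite -[in RHS]FAB; apply: measureD => //.
    by rewrite ltey_eq fin_num_measure.
  by rewrite PAB PF subee // fin_numD !fin_num_measure.
have -> : F `&` E = (A `&` E `|` B `&` E) `|` (F `\` (A `|` B)) `&` E.
  apply/seteqP; split=> [w [Fw Ew]|w].
    by have [?|?] := pselect ((A `|` B) w); [left; rewrite -setIUl|right].
  by case=> [[[/AF]|[/BF]]|[[]]].
rewrite measureU0.
- apply: measureU; [exact: measurableI|exact: measurableI|].
  by rewrite setIACA AB set0I.
- by apply: measurableU; apply: measurableI.
- exact: measurableI.
- apply: (subset_measure0 _ mN _ N0); first exact: measurableI.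
  exact: subIsetl.
Qed.

Lemma cookie_ext (s s' : nat -> int) (n : nat) :
  (forall k, (k <= n)%N -> s k = s' k) -> cookie s n = cookie s' n.
Proof.
elim: n => [//|n IHn] ss'; apply/funext => y /=.
by rewrite IHn ?ss' // => k kn; apply: ss'; exact: leqW.
Qed.

Section Law.
Variables (R : realType) (p : R) (d : measure_display) (T : measurableType d).
Variables (P : probability T R) (x : int) (X : nat -> {RV P >-> int}).
Hypothesis hX : is_HYC p x X.

Let hits0 (m t : nat) : set T :=
  [set w | exists2 k, (k <= t)%N & X (m + k)%N w = 0].

Lemma measurable_at n y : measurable [set w | X n w = y].
Proof.
rewrite (_ : mkset _ = X n @^-1` [set y]) // -[X in measurable X]setTI.
by apply: (measurable_funPT (X n)) => //; exact: I.
Qed.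

Lemma measurable_hits0 m t : measurable (hits0 m t).
Proof.
rewrite (_ : hits0 m t =
    \bigcup_(k in [set k | (k <= t)%N]) [set w | X (m + k)%N w = 0]); last first.
  by apply/seteqP; split=> w [k ? ?]; exists k.
by apply: bigcup_measurable => k _; exact: measurable_at.
Qed.

Lemma measurable_follows s n : measurable (follows X s n).
Proof.
rewrite (_ : follows _ _ _ =
    \bigcap_(k in [set k | (k <= n)%N]) [set w | X k w = s k]); last first.
  by apply/seteqP; split=> w.
by apply: bigcap_measurable => [|k _]; [exists 0%N|exact: measurable_at].
Qed.

Let extend (s : nat -> int) (m : nat) (y : int) : nat -> int :=
  fun k => if (k <= m)%N then s k else y.

Lemma follows_extend s m y :
  follows X s m `&` [set w | X m.+1 w = y] = follows X (extend s m y) m.+1.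
Proof.
apply/seteqP; split=> [w [fw Xw] k|w fw].
  rewrite leq_eqVlt ltnS /extend => /orP[/eqP ->|km]; first by rewrite ltnn.
  by rewrite km; exact: fw.
split=> [k km|] /=.
  by rewrite (fw k (leqW km)) /extend km.
by rewrite (fw _ (leqnn _)) /extend ltnn.
Qed.

Lemma cookie_extend_right s m :
  cookie (extend s m (s m + 1)) m.+1 = cookie s m.
Proof.
apply/funext => y /=; rewrite (@cookie_ext _ s m); last first.
  by move=> k km; rewrite /extend km.
rewrite /extend leqnn ltnn.
have -> : (s m == y) && (s m + 1 == y - 1) = false by lia.
by rewrite andbT.
Qed.

Lemma cookie_extend_left s m :
  cookie (extend s m (s m - 1)) m.+1 = eat (cookie s m) (s m).
Proof.
apply/funext => y /=; rewrite (@cookie_ext _ s m); last first.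
  by move=> k km; rewrite /extend km.
by rewrite /extend leqnn ltnn /eat; congr (_ && _); lia.
Qed.

Lemma hyc_leftE s m : hyc_left p s m = 1 - right_prob p (cookie s m) (s m).
Proof. by rewrite /hyc_left /right_prob; case: ifP => // _; field. Qed.

(** The Markov property of positions with cookies: given the first [m] steps, the
    conditional probability of hitting [0] within [t] more steps depends on the
    past only through the current position and cookies. *)
Lemma follows_hits0 t s m : P (follows X s m `&` hits0 m t) =
  ((reach p origin xpredT t (s m) (cookie s m))%:E * P (follows X s m))%E.
Proof.
elim: t s m => [|t IHt] s m.
  rewrite /= /origin; case: eqP => sm.
    rewrite mul1e; congr (P _); apply: setIidl => w fw.
    by exists 0%N => //; rewrite addn0 (fw m).
  rewrite mul0e (_ : _ `&` _ = set0) ?measure0 //.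
  apply/seteqP; split=> // w [fw [k]]; rewrite leqn0 => /eqP ->.
  by rewrite addn0 (fw m).
rewrite [reach _ _ _ _]/= {1}/origin; case: eqP => sm.
  rewrite mul1e; congr (P _); apply: setIidl => w fw.
  by exists 0%N => //; rewrite addn0 (fw m).
(* the walk is not at [0] at time [m], so the window can start at [m.+1] *)
have -> : follows X s m `&` hits0 m t.+1 = follows X s m `&` hits0 m.+1 t.
  apply/seteqP; split=> w [fw [k kt Xk]]; split=> //.
    case: k kt Xk => [|k] kt Xk; first by move: Xk; rewrite addn0 (fw m).
    by exists k => //; rewrite addSnnS.
  by exists k.+1 => //; rewrite addnS -addSn.
rewrite (@probability_split _ _ _ _ _
  (follows X s m `&` [set w | X m.+1 w = s m + 1])
  (follows X s m `&` [set w | X m.+1 w = s m - 1])).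
- rewrite !follows_extend !IHt -!follows_extend (hyc_stepR hX) (hyc_stepL hX).
  rewrite cookie_extend_right cookie_extend_left hyc_leftE.
  have extE y : extend s m y m.+1 = y by rewrite /extend ltnn.
  rewrite !extE /mean_step -/(right_prob p (cookie s m) (s m)).
  rewrite /hyc_right -/(right_prob p (cookie s m) (s m)) !muleA -!EFinM.
  have -> : P (follows X s m) = (fine (P (follows X s m)))%:E.
    by rewrite fineK ?fin_num_measure //; exact: measurable_follows.
  by rewrite -!EFinM -EFinD; congr EFin; ring.
- exact: measurable_follows.
- by apply: measurableI; [exact: measurable_follows|exact: measurable_at].
- by apply: measurableI; [exact: measurable_follows|exact: measurable_at].
- exact: measurable_hits0.
- exact: subIsetl.
- exact: subIsetl.
- apply/seteqP; split=> // w [[_ /= ->]] [_] /eqP; lia.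
- rewrite (hyc_stepR hX) (hyc_stepL hX) hyc_leftE.
  rewrite /hyc_right -/(right_prob p (cookie s m) (s m)).
  have -> : P (follows X s m) = (fine (P (follows X s m)))%:E.
    by rewrite fineK ?fin_num_measure //; exact: measurable_follows.
  by rewrite -!EFinM -EFinD; congr EFin; ring.
Qed.

Lemma hits0_from_start t :
  P (hits0 0 t) = (reach p origin xpredT t x (fun=> true))%:E.
Proof.
have follows0 : follows X (fun=> x) 0 = [set w | X 0%N w = x].
  apply/seteqP; split=> [w /(_ 0%N (leqnn _))//|w Xw k].
  by rewrite leqn0 => /eqP ->.
rewrite -[hits0 0 t]setTI.
rewrite (@probability_split _ _ _ _ _ (follows X (fun=> x) 0) set0) //.
- by rewrite follows_hits0 follows0 (hyc_start hX) mule1 set0I measure0 adde0.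
- exact: measurable_follows.
- exact: measurable_hits0.
- by rewrite setI0.
- by rewrite follows0 (hyc_start hX) measure0 adde0 probability_setT.
Qed.

Lemma hitting_time_infinite :
  [set w | hitting_time R X 0 w = +oo%E] = ~` \bigcup_t hits0 0 t.
Proof.
apply/seteqP; split=> w.
  move=> /= hit_oo [t _ [k _ Xk]].
  have : (hitting_time R X 0 w <= k%:R%:E)%E.
    by apply: ereal_inf_lbound; exists k.
  by rewrite hit_oo leye_eq.
move=> never /=; rewrite /hitting_time.
rewrite (_ : [set n | X n w = 0] = set0) ?image_set0 ?ereal_inf0 //.
by apply/seteqP; split=> // k Xk; apply: never; exists k => //; exists k.
Qed.

Lemma survival_probability (p_gt_half : 2^-1 < p) (p_lt1 : p < 1) :
  P [set w | hitting_time R X 0 w = +oo%E] =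
  (1 - reach_ever p origin xpredT x (fun=> true))%:E.
Proof.
have mU : measurable (\bigcup_t hits0 0 t).
  by apply: bigcup_measurable => t _; exact: measurable_hits0.
rewrite hitting_time_infinite probability_setC // EFinB; congr (_ - _)%E.
have nd : nondecreasing_seq (hits0 0).
  move=> t u tu; apply/subsetPset => w [k kt Xk].
  by exists k => //; exact: leq_trans tu.
have lim1 := nondecreasing_cvg_mu (mu := P) (measurable_hits0 0) mU nd.
have <- : limn (P \o hits0 0) = P (\bigcup_t hits0 0 t) by exact: cvg_lim lim1.
apply: cvg_lim => //.
have -> : P \o hits0 0 =
    EFin \o (fun t => reach p origin xpredT t x (fun=> true)).
  by apply/funext => t /=; exact: hits0_from_start.
by apply: cvg_EFin; [exact: nearW|exact: reach_cvg].
Qed.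

End Law.

Theorem theorem1p3 (R : realType) (p : R) (hp1 : 2 / 3 < p) (hp2 : p < 1)
    (d : measure_display) (T : measurableType d) (P : probability T R)
    (X : nat -> {RV P >-> int}) (hX : is_HYC p 1 X) :
  P [set w | hitting_time R X 0 w = +oo%E] = ((3 * p - 2) / (2 * p - 1))%:E.
Proof.
have p_gt_half : 2^-1 < p by lra.
rewrite (survival_probability hX) //; congr EFin.
have q0 : 0 < 1 - p by lra.
have r0 : 0 < 2 * p - 1 by lra.
transitivity (1 - ((2 * p - 1) / (1 - p))^-1); last first.
  by field; rewrite !gt_eqF.
apply: (@renewal_limit _ _ _ (cross1 p)).
- by rewrite ltr_pdivlMr //; lra.
- by move=> n; rewrite cross1_ge0 // cross1_le1.
- by move=> m n; exact: le_cross1.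
- exact: cross1_cvg.
- by move=> n n0; exact: cross1_renewal.
Qed.
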